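(* For a (finite, simple, nontrivial, connected) bipartite graph $G$, deciding whether $rc(G)=2$ can be done in polynomial time.
   Context: Let $G$ be a nontrivial connected graph with an edge-coloring $c: E(G)\rightarrow\{1,2,\ldots,k\}$, where adjacent edges may receive the same color. A path is a rainbow path if no two of its edges have the same color. $G$ is rainbow connected with respect to $c$ if every two vertices $u,v$ of $G$ are joined by a rainbow $u$-$v$ path; such a $c$ is a rainbow coloring. The rainbow connection number $rc(G)$ is the smallest number of colors in a rainbow coloring of $G$. *)

(* Defs.v *)
From mathcomp Require Import all_boot.
Set Implicit Arguments. Unset Strict Implicit. Unset Printing Implicit Defensive.

Definition simple_graph (n : nat) (e : rel 'I_n) : Prop :=
  (forall x y, e x y = e y x) /\ (forall x, ~~ e x x).

Definition connected_graph (n : nat) (e : rel 'I_n) : Prop :=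
  forall u v, connect e u v.

Definition bipartite (n : nat) (e : rel 'I_n) : Prop :=
  exists side : 'I_n -> bool, forall x y, e x y -> side x != side y.

(* An edge-coloring with colors {1,...,k} (represented by 'I_k): a     *)
(* function on unordered pairs, i.e. a symmetric function of the two   *)
(* endpoints (only its values on edges matter). Adjacent edges may get *)
(* the same color.                                                     *)
Definition edge_coloring (n k : nat) (c : 'I_n -> 'I_n -> 'I_k) : Prop :=
  forall x y, c x y = c y x.

Definition rainbow_path (n k : nat) (e : rel 'I_n) (c : 'I_n -> 'I_n -> 'I_k)
    (u v : 'I_n) (p : seq 'I_n) : Prop :=
  [/\ path e u p, last u p = v, uniq (u :: p) & uniq (pairmap c u p)].

Definition rainbow_coloring (n k : nat) (e : rel 'I_n)
    (c : 'I_n -> 'I_n -> 'I_k) : Prop :=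
  edge_coloring c /\ forall u v, exists p, rainbow_path e c u v p.

Definition rc_eq (n : nat) (e : rel 'I_n) (m : nat) : Prop :=
  (exists c : 'I_n -> 'I_n -> 'I_m, rainbow_coloring e c) /\
  (forall k, k < m -> ~ exists c : 'I_n -> 'I_n -> 'I_k, rainbow_coloring e c).

Inductive move := MoveL | MoveR | Stay.

Record TM := {
  tm_state : finType;
  tm_sym : finType;
  tm_blank : tm_sym;
  tm_zero : tm_sym;
  tm_one : tm_sym;
  tm_start : tm_state;
  tm_acc : tm_state;
  tm_rej : tm_state;
  tm_delta : tm_state -> tm_sym -> tm_state * tm_sym * move
}.

Definition tm_wf (M : TM) : Prop :=
  [/\ tm_blank M != tm_zero M, tm_blank M != tm_one M,
      tm_zero M != tm_one M & tm_acc M != tm_rej M].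

(* configuration: state, (left part of tape nearest cell first,        *)
(* scanned symbol, right part of tape); tape is blank beyond the lists *)
Definition config (M : TM) :=
  (tm_state M * (seq (tm_sym M) * tm_sym M * seq (tm_sym M)))%type.

Definition tm_step (M : TM) (cf : config M) : config M :=
  let: (q, (l, a, r)) := cf in
  if (q == tm_acc M) || (q == tm_rej M) then cf else
  let: (q', b, m) := tm_delta q a in
  match m with
  | Stay => (q', (l, b, r))
  | MoveL => match l with
             | [::] => (q', ([::], tm_blank M, b :: r))
             | x :: l' => (q', (l', x, b :: r))
             end
  | MoveR => match r with
             | [::] => (q', (b :: l, tm_blank M, [::]))
             | x :: r' => (q', (b :: l, x, r'))
             end
  end.

Definition tm_enc (M : TM) (b : bool) : tm_sym M :=
  if b then tm_one M else tm_zero M.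

Definition tm_init (M : TM) (w : seq bool) : config M :=
  match w with
  | [::] => (tm_start M, ([::], tm_blank M, [::]))
  | b :: w' => (tm_start M, ([::], tm_enc M b, map (tm_enc M) w'))
  end.

Definition tm_run (M : TM) (t : nat) (w : seq bool) : config M :=
  iter t (@tm_step M) (tm_init M w).

Definition graph_code (n : nat) (e : rel 'I_n) : seq bool :=
  [seq e i j | i <- enum 'I_n, j <- enum 'I_n].

(* Main.v *)
Require Import Defs.
From mathcomp Require Import all_boot zify.
Set Implicit Arguments. Unset Strict Implicit. Unset Printing Implicit Defensive.

(* A 2-coloured rainbow path has at most two edges, and in a bipartite graph two
   vertices on opposite sides are at odd distance; so rc(G) <= 2 forces G to be a
   complete bipartite K_{s,t}, whose edge colourings are 0/1 matrices of size s x t.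
   The colouring is rainbow iff the rows of the matrix are distinct and so are its
   columns; such a matrix exists iff t <= 2^s and s <= 2^t, and one colour fails iff
   there are at least 3 vertices.

   In terms of the adjacency matrix, G is complete bipartite iff every row is the first
   row or its complement, and s, t count the zeros and ones of the first row.  This is
   checked by a program with finitely many registers holding numbers at most N, the
   length of the input w: a register with value p < N is a mark on the p-th cell of the
   tape, and the value N is the absence of a mark.  One instruction is one left-to-right
   sweep of the head followed by a return.  All loops run exactly N times, so programs
   compute functions defined by iteration of length N, with values truncated at N, and
   take polynomial time. *)

(** * Register programs on a Turing machine *)

Inductive instr :=
  | IZero of nat
  | IInc of nat
  | ICopy of nat & nat
  | ILt of nat & nat & nat
  | IBit of nat & nat
  | IBack of nat.

Definition store := nat -> nat.

Definition upd (s : store) (r v : nat) : store :=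
  fun i => if i == r then v else s i.

Definition effect (w : seq bool) (i : instr) (s : store) : store :=
  match i with
  | IZero r => upd s r 0
  | IInc r => upd s r (minn (size w) (s r).+1)
  | ICopy r r' => upd s r (s r')
  | _ => s
  end.

Definition test (w : seq bool) (i : instr) (s : store) : bool :=
  match i with
  | ILt r r' _ => s r < s r'
  | IBit r _ => nth false w (s r)
  | _ => false
  end.

(** Jumps are relative, so code can be placed at any offset. The test of [ILt 0 0 k] always fails,
    which makes it an unconditional forward jump. *)
Definition next_pc (i : instr) (pc : nat) (b : bool) : nat :=
  match i with
  | ILt _ _ k | IBit _ k => if b then pc.+1 else pc.+1 + k
  | IBack k => pc - k
  | _ => pc.+1
  end.

Definition step (C : seq instr) (w : seq bool) (x : nat * store) : nat * store :=
  if onth C x.1 is Some i then (next_pc i x.1 (test w i x.2), effect w i x.2) else x.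

Definition bounded (w : seq bool) (s : store) := forall r, s r <= size w.

Lemma bounded_effect w i s : 0 < size w -> bounded w s -> bounded w (effect w i s).
Proof.
move=> w0 bs; case: i => //= [r|r|r r'] j; rewrite /upd; case: eqP => // _.
exact: geq_minl.
Qed.

Definition max_reg (i : instr) : nat :=
  match i with
  | IZero r | IInc r | IBit r _ => r
  | ICopy r r' | ILt r r' _ => maxn r r'
  | IBack _ => 0
  end.

(** * One sweep of the head as a Mealy transducer *)

Section Sweep.

Variable K : nat.

Definition marks_type := {ffun 'I_K.+1 -> bool}.
Definition cell := (bool * marks_type)%type.

Definition get_mark (m : marks_type) (r : nat) : bool := m (inord r).
Definition set_mark (m : marks_type) (r : nat) (b : bool) : marks_type :=
  [ffun i => if i == inord r then b else m i].

(* The second component of the state is the outcome of the test; the first one says,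
   for [IZero] and [ILt], that the decisive cell has been passed, and carries the mark
   to the next cell for [IInc]. *)
Definition mealy (i : instr) (st : bool * bool) (x : cell) : (bool * bool) * cell :=
  let: (b, m) := x in
  match i with
  | IZero r => ((true, false), (b, set_mark m r (~~ st.1)))
  | IInc r => ((get_mark m r, false), (b, set_mark m r st.1))
  | ICopy r r' => (st, (b, set_mark m r (get_mark m r')))
  | ILt r r' _ =>
      let a := get_mark m r in let a' := get_mark m r' in
      (if st.1 then st else (a || a', a && ~~ a'), x)
  | IBit r _ => ((false, st.2 || get_mark m r && b), x)
  | IBack _ => (st, x)
  end.

Fixpoint sweep (i : instr) (st : bool * bool) (cs : seq cell) :=
  if cs is x :: cs' then
    let: (st1, y) := mealy i st x in
    let: (st2, ys) := sweep i st1 cs' in (st2, y :: ys)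
  else (st, [::]).

Definition marks (s : store) (p : nat) : marks_type := [ffun i : 'I_K.+1 => s i == p].

Fixpoint cells (p : nat) (w : seq bool) (s : store) : seq cell :=
  if w is b :: w' then (b, marks s p) :: cells p.+1 w' s else [::].

Lemma size_cells p w s : size (cells p w s) = size w.
Proof. by elim: w p => //= b w IH p; rewrite IH. Qed.

Lemma get_marks s p r : r <= K -> get_mark (marks s p) r = (s r == p).
Proof. by move=> rK; rewrite /get_mark ffunE inordK. Qed.

Lemma set_marks s p r v : r <= K -> set_mark (marks s p) r (v == p) = marks (upd s r v) p.
Proof.
move=> rK; apply/ffunP => i; rewrite !ffunE /upd -(inj_eq val_inj) /= inordK //.
by case: eqP.
Qed.

(** The flag [0 < p] is the one carried after [p] cells, which lets the induction run over suffixes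
    of the tape. *)
Lemma sweep_zero p w s r : r <= K ->
  exists a, sweep (IZero r) (0 < p, false) (cells p w s)
    = ((a, false), cells p w (upd s r 0)).
Proof.
move=> rK; elim: w p => [|b w IH] p /=; first by eexists.
have [a ->] := IH p.+1.
by exists a; rewrite -set_marks //; congr (_, (_, set_mark _ _ _) :: _); case: p.
Qed.

(** The flag tells whether the previous cell held the mark. A mark pushed off the last cell
    disappears, and this is the value [N]. *)
Lemma sweep_inc N p w s r : r <= K -> p + size w = N -> s r <= N ->
  exists a, sweep (IInc r) ((s r).+1 == p, false) (cells p w s)
    = ((a, false), cells p w (upd s r (minn N (s r).+1))).
Proof.
move=> rK; elim: w p => [|b w IH] p /= pN sN; first by eexists.
rewrite get_marks // -eqSS; have [|//|a ->] := IH p.+1; first by rewrite -pN addnS.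
exists a; rewrite -set_marks //; congr (_, (_, set_mark _ _ _) :: _).
lia.
Qed.

Lemma sweep_copy st p w s r r' : r <= K -> r' <= K ->
  sweep (ICopy r r') st (cells p w s) = (st, cells p w (upd s r (s r'))).
Proof.
move=> rK rK'; elim: w p => [//|b w IH] p /=.
by rewrite get_marks // IH set_marks.
Qed.

Lemma sweep_lt_done k b p w s r r' :
  sweep (ILt r r' k) (true, b) (cells p w s) = ((true, b), cells p w s).
Proof. by elim: w p => [//|b' w IH] p /=; rewrite IH. Qed.

(** The first cell with either mark decides. If there is none, both values are the end of the tape
    and the test fails. *)
Lemma sweep_lt k p w s r r' : r <= K -> r' <= K ->
  p <= s r <= p + size w -> p <= s r' <= p + size w ->
  exists a, sweep (ILt r r' k) (false, false) (cells p w s)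
    = ((a, s r < s r'), cells p w s).
Proof.
move=> rK rK'; elim: w p => [|b w IH] p /= h h'.
  by exists false; congr (_, _, _); lia.
rewrite !get_marks //.
case: (eqVneq (s r) p) => [e|ne] /=.
  by rewrite sweep_lt_done; eexists; congr (_, _, _); lia.
case: (eqVneq (s r') p) => [e'|ne'] /=.
  by rewrite sweep_lt_done; eexists; congr (_, _, _); lia.
have [||a ->] := IH p.+1; [lia|lia|].
by exists a.
Qed.

(** A register that marks no cell reads the default [false] of [nth]. *)
Lemma sweep_bit k c p w s r : r <= K ->
  exists a, sweep (IBit r k) (false, c) (cells p w s)
    = ((a, c || (p <= s r) && nth false w (s r - p)), cells p w s).
Proof.
move=> rK; elim: w p c => [|b w IH] p c /=.
  by exists false; rewrite nth_nil andbF orbF.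
rewrite get_marks //; have [a ->] := IH p.+1 (c || (s r == p) && b).
exists a; congr (_, _, _).
case: (ltngtP p (s r)) => [lt|gt|->] /=.
- by rewrite orbF; have -> : s r - p = (s r - p.+1).+1 by lia.
- by rewrite !orbF.
- by rewrite subnn orbF.
Qed.

Lemma sweepE w i s : max_reg i <= K -> bounded w s ->
  exists a, sweep i (false, false) (cells 0 w s)
    = ((a, test w i s), cells 0 w (effect w i s)).
Proof.
case: i => [r|r|r r'|r r' k|r k|k] /=; rewrite ?geq_max => rK bs.
- exact: (@sweep_zero 0).
- exact: (@sweep_inc (size w) 0).
- by case/andP: rK => *; exists false; apply: sweep_copy.
- by case/andP: rK => *; apply: sweep_lt => //; rewrite add0n bs.
- by have [a] := @sweep_bit k false 0 w s r rK; rewrite /= subn0; exists a.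
- by exists false; elim: w {bs} 0 => //= b w IH p; rewrite IH.
Qed.

End Sweep.

Lemma max_reg_onth C pc i : onth C pc = Some i -> max_reg i <= \max_(j <- C) max_reg j.
Proof.
elim: C pc => [|j C IH] [|pc] //=; rewrite big_cons leq_max; first by case=> ->; rewrite leqnn.
by move/IH=> ->; rewrite orbT.
Qed.

(** * The Turing machine of a register program *)

Section Compile.

Variable C : seq instr.

Definition width : nat := \max_(i <- C) max_reg i.

Notation fetch := (nth (IBack 0) C).

(* [inl b]: halted with verdict [b]; [inr (pc, Some st)]: sweeping right with Mealy
   state [st]; [inr (pc, None)]: returning to the left end.  The verdict is acceptance
   if the final [pc] is [size C], rejection if it is beyond. *)
Definition compiled_state : finType :=
  (bool + 'I_(size C).+1 * option (bool * bool))%type.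
Definition compiled_sym : finType := option (bool * {ffun 'I_width.+1 -> bool}).

Definition compiled_delta (q : compiled_state) (a : compiled_sym) :
    compiled_state * compiled_sym * move :=
  match q with
  | inl b => (q, a, Stay)
  | inr (pc, Some st) =>
      if a is Some x then
        let: (st', y) := @mealy width (fetch pc) st x in
        (inr (pc, Some st'), Some y, MoveR)
      else
        let pc' := next_pc (fetch pc) pc st.2 in
        if pc' < size C then (inr (inord pc', None), None, MoveL)
        else (inl (pc' == size C), None, Stay)
  | inr (pc, None) =>
      if a is Some x then (q, a, MoveL)
      else (inr (pc, Some (false, false)), None, MoveR)
  end.

(** The input symbols carry no marks, so the initial tape represents the store with every register
    equal to the input length. *)
Definition compiled : TM :=
  @Build_TM compiled_state compiled_sym None
    (Some (false, [ffun=> false])) (Some (true, [ffun=> false]))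
    (inr (ord0, Some (false, false))) (inl true) (inl false) compiled_delta.

Lemma compiled_wf : tm_wf compiled.
Proof. by split. Qed.

(** Here and in [lconf] the scanned cell is the head of one of the lists, a blank if that list is
    empty; a move then has the same form inside the tape and at its end. *)
Definition rconf (q : compiled_state) (l r : seq compiled_sym) : config compiled :=
  if r is x :: r' then (q, (l, x, r')) else (q, (l, None, [::])).

Definition lconf (q : compiled_state) (l r : seq compiled_sym) : config compiled :=
  if l is x :: l' then (q, (l', x, r)) else (q, ([::], None, r)).

Lemma run_right (pc : 'I_(size C).+1) st (cs : seq (cell width)) l b :
  let: (st', cs') := sweep (fetch pc) st cs in
  iter (size cs) (@tm_step compiled)
    (rconf (inr (pc, Some st)) l (map Some cs ++ nseq b None))
  = rconf (inr (pc, Some st')) (catrev (map Some cs') l) (nseq b None).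
Proof.
elim: cs st l => [//|x cs IH] st l; rewrite iterSr /=.
case: (mealy _ _ _) => st1 y; move: (IH st1 (Some y :: l)).
case: (sweep _ _ _) => st2 ys <-; congr (iter _ _ _).
Qed.

Lemma run_left (pc : 'I_(size C).+1) (cs : seq (cell width)) a r :
  iter (size cs) (@tm_step compiled)
    (lconf (inr (pc, None)) (map Some cs ++ nseq a None) r)
  = lconf (inr (pc, None)) (nseq a None) (catrev (map Some cs) r).
Proof.
elim: cs r => [//|x cs IH] r; by rewrite iterSr -IH.
Qed.

(* The blanks on both sides grow by at most one cell, when the head first
   leaves the input; [a] and [b] only record which of the two it is. *)
Definition tape_conf (pc : 'I_(size C).+1) (w : seq bool) (s : store) (a b : nat) :
    config compiled :=
  rconf (inr (pc, Some (false, false))) (nseq a None)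
    (map Some (@cells width 0 w s) ++ nseq b None).

(** The sweep takes [size w] steps, the turn at the right blank one, the return [size w], the turn
    at the left blank one. A halting program stops at the first turn. *)
Lemma compiled_step (pc : 'I_(size C).+1) w s a b :
  0 < size w -> bounded w s -> pc < size C ->
  let: (pc', s') := step C w (val pc, s) in
  if pc' < size C then exists a' b',
    iter (size w + (size w).+2) (@tm_step compiled) (tape_conf pc w s a b)
      = tape_conf (inord pc') w s' a' b'
  else (iter (size w).+1 (@tm_step compiled) (tape_conf pc w s a b)).1
    = inl (pc' == size C).
Proof.
move=> w0 bs pcC; have onthC : onth C pc = Some (fetch pc).
  by rewrite onthE (nth_map (IBack 0)).
rewrite /step /= onthC.
set i := fetch pc; set s' := effect w i s; set pc' := next_pc _ _ _.
have iK : max_reg i <= width by apply: max_reg_onth onthC.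
have [a1 sw] := sweepE iK bs.
have run := @run_right pc (false, false) (cells width 0 w s) (nseq a None) b.
rewrite -/i sw -/s' size_cells in run.
(* The input is nonempty, so the turn at the right blank lands on a cell [y] of it. *)
have [y [cs' cs'E]] : exists y cs', catrev (map Some (cells width 0 w s')) (nseq a None)
    = map Some (y :: cs') ++ nseq a (None : compiled_sym)
    /\ y :: cs' = rev (cells width 0 w s').
  have: size (rev (cells width 0 w s')) != 0 by rewrite size_rev size_cells -lt0n.
  case E: (rev _) => [//|y cs'] _; exists y, cs'; split=> //.
  by rewrite catrevE -map_rev E.
case: cs'E => cs'E yE.
case: ifP => [pcC'|pcC'].
  (* The visited blank joins the list only if the list was empty. *)
  exists a.-1.+1, b.-1.+1.
  rewrite addnC iterD run cs'E iterSr iterS.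
  have -> : tm_step (rconf (inr (pc, Some (a1, test w i s)))
      (map Some (y :: cs') ++ nseq a None) (nseq b None))
    = lconf (inr (inord pc', None)) (map Some (y :: cs') ++ nseq a None) (nseq b.-1.+1 None).
    by case: b {run} => [|b] /=; rewrite -/i -/pc' pcC'.
  rewrite -[size w](size_cells width 0 w s') -size_rev -yE run_left catrevE -map_rev yE revK.
  have: size (cells width 0 w s') != 0 by rewrite size_cells -lt0n.
  rewrite /tape_conf; case: (cells _ _ _ _) => // z zs _.
  by case: a {cs'E run} => [|a] /=.
rewrite run cs'E.
by case: b {run} => [|b] /=; rewrite -/i -/pc' pcC'.
Qed.

Lemma compiled_run T (pc : 'I_(size C).+1) w s a b :
  0 < size w -> bounded w s -> pc < size C ->
  size C <= (iter T (step C w) (val pc, s)).1 ->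
  exists2 t, t <= T * (size w + (size w).+2) &
    (iter t (@tm_step compiled) (tape_conf pc w s a b)).1
      = inl ((iter T (step C w) (val pc, s)).1 == size C).
Proof.
move=> w0; elim: T pc s a b => [|T IH] pc s a b bs pcC /=; first by rewrite leqNgt pcC.
rewrite -iterS iterSr.
have bs' : bounded w (step C w (val pc, s)).2.
  by rewrite /step /=; case: (onth _ _) => //= i; apply: bounded_effect.
have := compiled_step a b w0 bs pcC.
case: (step _ _ _) bs' => pc' s' /= bs'; case: ltnP => [pcC' [a' [b' e]]|leC e].
  have pcE : val (inord pc' : 'I_(size C).+1) = pc' by rewrite /= inordK // ltnW.
  move=> leC; have [|||t tle te] := IH (inord pc') s' a' b' => //; rewrite ?pcE //.
  rewrite pcE in te.
  exists (t + (size w + (size w).+2)); first by rewrite mulSn addnC leq_add2l.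
  by rewrite iterD e te.
move=> _; exists (size w).+1; first by rewrite mulSn; lia.
rewrite e; congr (inl (_ == _)).
(* A program counter beyond the code is a fixed point of [step], so the remaining iterations change
   nothing. *)
have /= -> // := iter_fix T (x := (pc', s')).
by rewrite /step onth_default.
Qed.

End Compile.

(** * Functions computed in polynomial time *)

(** With [1 < N] a bare power absorbs constants: [k < 2 ^ k], and a sum of two powers costs one more
    exponent. *)
Definition poly_bounded (f : nat -> nat) :=
  exists d, forall N, 1 < N -> f N <= N ^ d.

Lemma poly_const k : poly_bounded (fun=> k).
Proof.
exists k => N N1; apply: leq_trans (ltnW (ltn_expl k (ltnSn 1))) _.
by case: k => // k; rewrite leq_exp2r.
Qed.

Lemma poly_id : poly_bounded id.
Proof. by exists 1. Qed.

Lemma poly_mul f g : poly_bounded f -> poly_bounded g ->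
  poly_bounded (fun N => f N * g N).
Proof.
by case=> a fa [b gb]; exists (a + b) => N N1; rewrite expnD leq_mul ?fa ?gb.
Qed.

Lemma poly_add f g : poly_bounded f -> poly_bounded g ->
  poly_bounded (fun N => f N + g N).
Proof.
case=> a fa [b gb]; exists (maxn a b).+1 => N N1.
have N0 : 0 < N by apply: ltnW.
apply: leq_trans (leq_add (fa N N1) (gb N N1)) _.
apply: (@leq_trans (2 * N ^ maxn a b)); last by rewrite expnS leq_mul2r N1 orbT.
by rewrite mul2n -addnn leq_add // leq_pexp2l ?leq_maxl ?leq_maxr.
Qed.

(** * Program fragments and their running time *)

Definition code_at (C : seq instr) (off : nat) (c : seq instr) :=
  forall i, i < size c -> onth C (off + i) = onth c i.

Lemma code_at_cat C off c1 c2 :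
  code_at C off (c1 ++ c2) -> code_at C off c1 /\ code_at C (off + size c1) c2.
Proof.
move=> h; split=> i ic.
  by rewrite h ?size_cat ?ltn_addr // onth_cat ic.
by rewrite -addnA h ?size_cat ?ltn_add2l // onth_cat ltnNge leq_addr /= addKn.
Qed.

Lemma code_at_cons C off i c :
  code_at C off (i :: c) -> onth C off = Some i /\ code_at C off.+1 c.
Proof.
rewrite -cat1s => /code_at_cat[h1 h2]; split; first by rewrite -[off]addn0 h1.
by rewrite -addn1.
Qed.

Section Reach.

Variables (C : seq instr) (w : seq bool).

Definition reach (T : nat) (x y : nat * store) :=
  exists2 t, t <= T & iter t (step C w) x = y.

Lemma reach_trans T1 T2 x y z : reach T1 x y -> reach T2 y z -> reach (T1 + T2) x z.
Proof.
case=> t1 le1 e1 [t2 le2 e2]; exists (t2 + t1); first by rewrite addnC leq_add.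
by rewrite iterD e1.
Qed.

Lemma reach_le T T' x y : T <= T' -> reach T x y -> reach T' x y.
Proof. by move=> le [t le' e]; exists t => //; apply: leq_trans le' le. Qed.

Lemma reach0 x : reach 0 x x. Proof. by exists 0. Qed.

Lemma reach1 pc s i : onth C pc = Some i ->
  reach 1 (pc, s) (next_pc i pc (test w i s), effect w i s).
Proof. by move=> e; exists 1 => //=; rewrite /step /= e. Qed.

(** A total-correctness Hoare triple with time bound [T]. *)
Definition runs (T off : nat) (c : seq instr) (s : store) (Q : store -> Prop) :=
  code_at C off c ->
  exists s', [/\ reach T (off, s) (off + size c, s'), bounded w s' & Q s'].

Lemma runs_post T off c s (Q Q' : store -> Prop) :
  (forall s', Q s' -> Q' s') -> runs T off c s Q -> runs T off c s Q'.
Proof. by move=> QQ' h /h[s' [r bs' /QQ' Qs']]; exists s'. Qed.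

Lemma runs_cat T1 T2 off c1 c2 s (Q1 Q2 : store -> Prop) :
  runs T1 off c1 s Q1 ->
  (forall s1, bounded w s1 -> Q1 s1 -> runs T2 (off + size c1) c2 s1 Q2) ->
  runs (T1 + T2) off (c1 ++ c2) s Q2.
Proof.
move=> h1 h2 /code_at_cat[/h1[s1 [r1 b1 Q1s]] cc2].
have [s2 [r2 b2 Q2s]] := h2 s1 b1 Q1s cc2.
exists s2; split=> //; rewrite size_cat addnA; exact: reach_trans r1 r2.
Qed.

Lemma runs_cons T off i c s (Q : store -> Prop) :
  0 < size w -> bounded w s -> next_pc i off (test w i s) = off.+1 ->
  (bounded w (effect w i s) -> runs T off.+1 c (effect w i s) Q) ->
  runs T.+1 off (i :: c) s Q.
Proof.
move=> w0 bs ni h /code_at_cons[ci cc].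
have [|s' [r bs' Qs']] := h _ cc; first exact: bounded_effect.
exists s'; split=> //=; rewrite -addSnnS -add1n; apply: reach_trans r.
by have := reach1 s ci; rewrite ni.
Qed.

Lemma runs_nil off s (Q : store -> Prop) : bounded w s -> Q s -> runs 0 off [::] s Q.
Proof. by move=> bs Qs _; exists s; split=> //; rewrite addn0; apply: reach0. Qed.

(** The instruction [ILt 0 0 (size c2)] jumps over the else branch; the 2 pays for the test and this
    jump. *)
Lemma runs_if T1 T2 off i c1 c2 s (Q : store -> Prop) :
  (forall b, next_pc i off b = if b then off.+1 else off.+1 + (size c1).+1) ->
  effect w i s = s ->
  (test w i s -> runs T1 off.+1 c1 s Q) ->
  (~~ test w i s -> runs T2 (off.+1 + (size c1).+1) c2 s Q) ->
  runs (T1 + T2 + 2) off (i :: c1 ++ ILt 0 0 (size c2) :: c2) s Q.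
Proof.
move=> ni ei h1 h2 /code_at_cons[ci /code_at_cat[cc1 /code_at_cons[cj cc2]]].
have := reach1 s ci; rewrite ei ni; case: ifP => [t|/negbT t] r.
  have [s' [r1 b1 Q1]] := h1 t cc1.
  exists s'; split=> //; have r2 := reach1 s' cj; rewrite /= ltnn in r2.
  apply: (@reach_le (1 + (T1 + 1))); first lia.
  apply: reach_trans r (reach_trans r1 _).
  by move: r2; rewrite /= size_cat /= !addnS !addSn addnA.
rewrite -addnS in cc2.
have [s' [r1 b1 Q1]] := h2 t cc2.
exists s'; split=> //; apply: (@reach_le (1 + T2)); first lia.
by apply: reach_trans r _; move: r1; rewrite /= size_cat /= !addnS !addSn addnA.
Qed.

(** Register [d] is the accumulator, [d.+1] the counter, [d.+2] the result of the body. A round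
    costs the body and four instructions; the last 1 is the failing test. *)
Lemma runs_loop T off c d s (f : nat -> nat -> nat) x :
  0 < size w -> 0 < d -> bounded w s -> s 0 = size w -> s d = x -> s d.+1 = 0 ->
  (forall s1, bounded w s1 -> (forall i, i < d -> s1 i = s i) ->
    runs T off.+1 c s1 (fun s2 => s2 d.+2 = f (s1 d.+1) (s1 d)
      /\ forall i, i < d.+2 -> s2 i = s1 i)) ->
  runs (size w * (T + 4) + 1) off
    (ILt d.+1 0 (size c + 3) :: c ++ [:: ICopy d d.+2; IInc d.+1; IBack (size c + 3)]) s
    (fun s' => s' d = iteri (size w) f x /\ forall i, i < d -> s' i = s i).
Proof.
move=> w0 d0 bs s0 sd sd1 hc /code_at_cons[cl /code_at_cat[cc]].
move=> /code_at_cons[c1 /code_at_cons[c2 /code_at_cons[c3 _]]].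
(* The loop invariant, with [k] rounds left to run. *)
suff loop k s1 : bounded w s1 -> (forall i, i < d -> s1 i = s i) ->
    s1 d.+1 + k = size w -> s1 d = iteri (s1 d.+1) f x ->
    exists s', [/\ reach (k * (T + 4) + 1) (off, s1) (off.+1 + (size c + 3), s'),
      bounded w s', s' d = iteri (size w) f x & forall i, i < d -> s' i = s i].
  have [//|||s' [r bs' Q1 Q2]] := loop (size w) s bs; rewrite ?sd1 ?add0n ?sd //.
  exists s'; split=> //; move: r; by rewrite /= size_cat addSnnS.
elim: k s1 => [|k IH] s1 b1 e1 k1 sd1'.
  have := reach1 s1 cl; rewrite /= (e1 0) // s0 -k1 addn0 ltnn => r.
  by exists s1; split=> //; rewrite sd1' -k1 addn0.
have r := reach1 s1 cl; rewrite /= (e1 0) // s0 -k1 addnS ltnS leq_addr in r.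
have [s2 [r2 b2 [sd2 e2]]] := hc s1 b1 e1 cc.
have r3 := reach1 s2 c1; have b3 := @bounded_effect w (ICopy d d.+2) s2 w0 b2.
have r4 := reach1 (upd s2 d (s2 d.+2)) c2.
have b4 := @bounded_effect w (IInc d.+1) _ w0 b3.
rewrite /= in r3 r4 b4.
set s4 := upd _ d.+1 _ in r4 b4.
have r5 := reach1 s4 c3; rewrite /= in r5.
have s4d : s4 d = f (s1 d.+1) (s1 d).
  by rewrite /s4 /upd eqn_leq ltnn andbF /= eqxx.
have s4d1 : s4 d.+1 = (s1 d.+1).+1.
  by rewrite /s4 /upd eqxx gtn_eqF //= e2 //; lia.
have [|||s' [r6 b6 Q1 Q2]] := IH s4 b4.
- move=> i id; rewrite /s4 /upd !ltn_eqF //=; first (rewrite e2 ?e1 //); lia.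
- by rewrite s4d1; lia.
- by rewrite s4d s4d1 /= -sd1'.
exists s'; split=> //.
apply: (@reach_le (1 + (T + (1 + (1 + (1 + (k * (T + 4) + 1))))))); first lia.
apply: reach_trans r (reach_trans r2 (reach_trans r3 (reach_trans r4 (reach_trans r5 _)))).
by have -> : (off.+1 + size c).+2 - (size c + 3) = off by lia.
Qed.

End Reach.

(* Register [0] permanently holds [size w] and [rho] lists the registers of the
   arguments; the code puts its result in register [d], preserving those below. *)
Definition computable (m : nat) (F : seq bool -> seq nat -> nat) :=
  exists gen : seq nat -> nat -> seq instr,
  exists2 cost : nat -> nat, poly_bounded cost &
  forall C w rho d s off, 1 < size w -> size rho = m -> all (ltn^~ d) rho -> 0 < d ->
    bounded w s -> s 0 = size w ->
    runs C w (cost (size w)) off (gen rho d) s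
      (fun s' => s' d = F w (map s rho) /\ forall i, i < d -> s' i = s i).

Lemma computable_ext m F G :
  (forall w v, 1 < size w -> size v = m -> all (leq^~ (size w)) v -> F w v = G w v) ->
  computable m F -> computable m G.
Proof.
move=> FG [gen [cost pc h]]; exists gen; exists cost => //.
move=> C w rho d s off w1 srho arho d0 bs s0.
rewrite -FG ?size_map //; first exact: h.
by rewrite all_map; apply/allP => i _ /=; apply: bs.
Qed.

Lemma eq_map_below (s s' : store) d rho :
  all (ltn^~ d) rho -> (forall i, i < d -> s' i = s i) -> map s' rho = map s rho.
Proof. by move=> /allP a e; apply/eq_in_map => i /a /e. Qed.

Lemma upd_eq s r v : upd s r v r = v.
Proof. by rewrite /upd eqxx. Qed.

Lemma upd_below s r v i : i < r -> upd s r v i = s i.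
Proof. by move=> ir; rewrite /upd ltn_eqF. Qed.

(** * Closure properties of computable functions *)

Lemma computable_var m i : i < m -> computable m (fun w v => nth 0 v i).
Proof.
move=> im; exists (fun rho d => [:: ICopy d (nth 0 rho i)]).
exists (fun=> 1); first exact: poly_const.
move=> C w rho d s off w1 srho arho d0 bs s0.
apply: runs_cons => // [|b1]; first exact: ltnW.
apply: runs_nil => //=; rewrite upd_eq (nth_map 0) ?srho //.
by split=> // j; apply: upd_below.
Qed.

Lemma computable_size m : computable m (fun w v => size w).
Proof.
exists (fun rho d => [:: ICopy d 0]); exists (fun=> 1); first exact: poly_const.
move=> C w rho d s off w1 srho arho d0 bs s0.
apply: runs_cons => // [|b1]; first exact: ltnW.
apply: runs_nil => //=; rewrite upd_eq.
by split=> // j; apply: upd_below.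
Qed.

Lemma computable0 m : computable m (fun w v => 0).
Proof.
exists (fun rho d => [:: IZero d]); exists (fun=> 1); first exact: poly_const.
move=> C w rho d s off w1 srho arho d0 bs s0.
apply: runs_cons => // [|b1]; first exact: ltnW.
apply: runs_nil => //=; rewrite upd_eq.
by split=> // j; apply: upd_below.
Qed.

Lemma computable_succ m F : computable m F ->
  computable m (fun w v => minn (size w) (F w v).+1).
Proof.
case=> gen [cost pc h]; exists (fun rho d => gen rho d ++ [:: IInc d]).
exists (fun N => cost N + 1); first exact: poly_add pc (poly_const 1).
move=> C w rho d s off w1 srho arho d0 bs s0.
apply: runs_cat (h _ _ _ _ _ _ w1 srho arho d0 bs s0) _ => s1 b1 [s1d e1].
apply: runs_cons => // [|b2]; first exact: ltnW.
apply: runs_nil => //=; rewrite upd_eq s1d.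
by split=> // j jd; rewrite upd_below ?e1.
Qed.

(** Arguments behave as de Bruijn indices: the newest bound value is in front. *)
Lemma computable_let m F G : computable m G -> computable m.+1 F ->
  computable m (fun w v => F w (G w v :: v)).
Proof.
case=> genG [costG pG hG] [genF [costF pF hF]].
exists (fun rho d => genG rho d ++ genF (d :: rho) d.+1 ++ [:: ICopy d d.+1]).
exists (fun N => costG N + (costF N + 1)).
  exact: poly_add pG (poly_add pF (poly_const 1)).
move=> C w rho d s off w1 srho arho d0 bs s0.
apply: runs_cat (hG _ _ _ _ _ _ w1 srho arho d0 bs s0) _ => s1 b1 [s1d e1].
have arho1 : all (ltn^~ d.+1) (d :: rho).
  by rewrite /= ltnSn; apply: sub_all arho => i /= /leqW.
apply: runs_cat (hF _ _ _ _ _ _ w1 _ arho1 _ b1 _) _; rewrite /= ?srho ?(e1 0) //.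
move=> s2 b2 [s2d e2]; apply: runs_cons => // [|b3]; first exact: ltnW.
apply: runs_nil => //=; rewrite upd_eq s2d /= s1d (eq_map_below arho e1).
by split=> // j jd; rewrite upd_below // e2 ?e1 // ltnW.
Qed.

Lemma computable_rename m m' F l : computable m F -> size l = m -> all (ltn^~ m') l ->
  computable m' (fun w v => F w (map (nth 0 v) l)).
Proof.
case=> gen [cost pc h] sl al; exists (fun rho => gen (map (nth 0 rho) l)).
exists cost => // C w rho d s off w1 srho arho d0 bs s0.
have -> : [seq nth 0 [seq s i | i <- rho] i | i <- l] = map s (map (nth 0 rho) l).
  rewrite -map_comp; apply/eq_in_map => i /(allP al) /= im'.
  by rewrite (nth_map 0) ?srho.
apply: h => //; first by rewrite size_map.
rewrite all_map; apply/allP => i /(allP al) /= im'.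
by apply: (allP arho); rewrite mem_nth ?srho.
Qed.

(** Weakening: moves a function of the outer arguments under [k] binders. *)
Lemma computable_drop k m F : computable m F ->
  computable (k + m) (fun w v => F w (drop k v)).
Proof.
move=> h; have := @computable_rename m (k + m) F (iota k m) h.
rewrite size_iota => /(_ erefl) h'; apply: computable_ext (h' _).
  move=> w v w1 sv _; congr (F w _).
  rewrite -[X in iota X m]addn0 iotaDl -map_comp.
  apply: (@eq_from_nth _ 0); rewrite size_map size_iota ?size_drop ?sv ?addKn //.
  by move=> i im; rewrite (nth_map 0) ?size_iota // nth_iota // nth_drop.
by apply/allP => i; rewrite mem_iota => /andP[].
Qed.

Lemma computable_if_lt m A B F G :
  computable m A -> computable m B -> computable m F -> computable m G ->
  computable m (fun w v => if A w v < B w v then F w v else G w v).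
Proof.
move=> [genA [costA pA hA]] [genB [costB pB hB]] [genF [costF pF hF]] [genG [costG pG hG]].
exists (fun rho d => genA rho d ++ genB rho d.+1 ++
  ILt d d.+1 (size (genF rho d)).+1 :: genF rho d ++
    ILt 0 0 (size (genG rho d)) :: genG rho d).
exists (fun N => costA N + (costB N + (costF N + costG N + 2))).
  by do !apply: poly_add => //; apply: poly_const.
move=> C w rho d s off w1 srho arho d0 bs s0.
apply: runs_cat (hA _ _ _ _ _ _ w1 srho arho d0 bs s0) _ => s1 b1 [s1d e1].
have arho1 : all (ltn^~ d.+1) rho by apply: sub_all arho => i /= /leqW.
apply: runs_cat (hB _ _ _ _ _ _ w1 srho arho1 _ b1 _) _; rewrite ?e1 //.
move=> s2 b2 [s2d e2].
have e2' i : i < d -> s2 i = s i by move=> id; rewrite e2 ?e1 // ltnW.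
rewrite (eq_map_below arho e1) in s2d.
have s2d' : s2 d = A w (map s rho) by rewrite e2.
rewrite -s2d -s2d' -!(eq_map_below arho e2').
apply: runs_if => //= [->|/negbTE->].
  apply: runs_post (hF _ _ _ _ _ _ w1 srho arho d0 b2 _); last by rewrite e2'.
  by move=> s3 [s3d e3]; split=> // i id; rewrite e3 ?e2'.
apply: runs_post (hG _ _ _ _ _ _ w1 srho arho d0 b2 _); last by rewrite e2'.
by move=> s3 [s3d e3]; split=> // i id; rewrite e3 ?e2'.
Qed.

Lemma computable_if_bit m A F G :
  computable m A -> computable m F -> computable m G ->
  computable m (fun w v => if nth false w (A w v) then F w v else G w v).
Proof.
move=> [genA [costA pA hA]] [genF [costF pF hF]] [genG [costG pG hG]].
exists (fun rho d => genA rho d ++ IBit d (size (genF rho d)).+1 :: genF rho d ++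
    ILt 0 0 (size (genG rho d)) :: genG rho d).
exists (fun N => costA N + (costF N + costG N + 2)).
  by do !apply: poly_add => //; apply: poly_const.
move=> C w rho d s off w1 srho arho d0 bs s0.
apply: runs_cat (hA _ _ _ _ _ _ w1 srho arho d0 bs s0) _ => s1 b1 [s1d e1].
rewrite -s1d -!(eq_map_below arho e1).
apply: runs_if => //= [->|/negbTE->].
  apply: runs_post (hF _ _ _ _ _ _ w1 srho arho d0 b1 _); last by rewrite e1.
  by move=> s3 [s3d e3]; split=> // i id; rewrite e3 ?e1.
apply: runs_post (hG _ _ _ _ _ _ w1 srho arho d0 b1 _); last by rewrite e1.
by move=> s3 [s3d e3]; split=> // i id; rewrite e3 ?e1.
Qed.

Lemma computable_iteri m F G : computable m F -> computable m.+2 G ->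
  computable m (fun w v =>
    iteri (size w) (fun i x => G w [:: x, i & v]) (F w v)).
Proof.
move=> [genF [costF pF hF]] [genG [costG pG hG]].
exists (fun rho d => genF rho d ++ IZero d.+1 ::
  let c := genG [:: d, d.+1 & rho] d.+2 in
  ILt d.+1 0 (size c + 3) :: c ++ [:: ICopy d d.+2; IInc d.+1; IBack (size c + 3)]).
exists (fun N => costF N + (N * (costG N + 4) + 1).+1).
  apply: poly_add => //.
  suff: poly_bounded (fun N => N * (costG N + 4) + 1 + 1).
    by case=> k hk; exists k => N /hk; rewrite [_ + 1 + 1]addn1.
  have pk := poly_const.
  by do !apply: poly_add => //; apply: poly_mul poly_id (poly_add pG (pk 4)).
move=> C w rho d s off w1 srho arho d0 bs s0.
have w0 := ltnW w1.
apply: runs_cat (hF _ _ _ _ _ _ w1 srho arho d0 bs s0) _ => s1 b1 [s1d e1].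
apply: runs_cons => //= b2; set s2 := upd _ _ _ in b2 *.
have s2d : s2 d = F w (map s rho) by rewrite /s2 upd_below.
have e2 i : i < d -> s2 i = s i by move=> id; rewrite /s2 upd_below ?e1 // ltnW.
apply: runs_post; last first.
  apply: (@runs_loop _ _ _ _ _ d s2 (fun i x => G w [:: x, i & map s rho])
            (F w (map s rho))) => //.
  - by rewrite e2.
  - by rewrite /s2 upd_eq.
  move=> s3 b3 e3.
  have arho2 : all (ltn^~ d.+2) [:: d, d.+1 & rho].
    by rewrite /= ltnSn leqnSn; apply: sub_all arho => i /= /leqW /leqW.
  have e3' i : i < d -> s3 i = s i by move=> id; rewrite e3 ?e2.
  rewrite -(eq_map_below arho e3').
  by apply: hG => //; rewrite ?(e3' 0) //= srho.
by move=> s3 [-> e3]; split=> // i id; rewrite e3 ?e2.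
Qed.

(** The result ends in a register of a bounded store. This bound ensures that a loop of [size w]
    rounds is long enough to count up to any computed value. *)
Lemma computable_le m F w v : computable m F ->
  1 < size w -> size v = m -> all (leq^~ (size w)) v -> F w v <= size w.
Proof.
case=> gen [cost pc h] w1 sv av.
(* Register 0 holds [size w], the next [m] registers hold [v], the others the default [size w]. *)
pose s i := nth (size w) (size w :: v) i.
have bs : bounded w s.
  case=> [|i]; rewrite /s //=; case: (ltnP i (size v)) => iv; last by rewrite nth_default.
  by apply: (allP av); apply: mem_nth.
have vE : map s (iota 1 m) = v.
  rewrite -[1]addn0 iotaDl -map_comp -sv; exact: mkseq_nth.
have am : all (ltn^~ m.+1) (iota 1 m).
  by apply/allP => i; rewrite mem_iota add1n => /andP[].
have [//|s' [_ bs' []]] := h (gen (iota 1 m) m.+1) w _ _ s 0 w1 (size_iota 1 m) am isT bs erefl.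
by rewrite vE => <- _.
Qed.

(** * Truncated arithmetic and bounded quantifiers *)

Lemma computable1 m : computable m (fun w v => 1).
Proof.
apply: computable_ext (computable_succ (computable0 m)) => w v w1 _ _.
exact/minn_idPr/ltnW.
Qed.

Lemma computable2 m : computable m (fun w v => 2).
Proof.
by apply: computable_ext (computable_succ (computable1 m)) => w v w1 _ _; apply/minn_idPr.
Qed.

Definition testable (m : nat) (P : seq bool -> seq nat -> bool) :=
  computable m (fun w v => nat_of_bool (P w v)).

Lemma computable_if m P F G : testable m P -> computable m F -> computable m G ->
  computable m (fun w v => if P w v then F w v else G w v).
Proof.
move=> hP hF hG; apply: computable_ext (computable_if_lt (computable0 m) hP hF hG).
by move=> w v _ _ _ /=; rewrite lt0b.
Qed.

Lemma testable_lt m A B : computable m A -> computable m B ->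
  testable m (fun w v => A w v < B w v).
Proof.
move=> hA hB.
apply: computable_ext (computable_if_lt hA hB (computable1 m) (computable0 m)) => w v _ _ _.
by case: ltnP.
Qed.

Lemma testable_bit m A : computable m A -> testable m (fun w v => nth false w (A w v)).
Proof.
move=> hA.
apply: computable_ext (computable_if_bit hA (computable1 m) (computable0 m)) => w v _ _ _.
by case: nth.
Qed.

Lemma testable_not m P : testable m P -> testable m (fun w v => ~~ P w v).
Proof.
move=> hP; apply: computable_ext (computable_if hP (computable0 m) (computable1 m)) => w v _ _ _.
by case: (P w v).
Qed.

Lemma testable_and m P Q : testable m P -> testable m Q ->
  testable m (fun w v => P w v && Q w v).
Proof.
move=> hP hQ; apply: computable_ext (computable_if hP hQ (computable0 m)) => w v _ _ _.
by case: (P w v).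
Qed.

Lemma testable_imply m P Q : testable m P -> testable m Q ->
  testable m (fun w v => P w v ==> Q w v).
Proof.
move=> hP hQ; apply: computable_ext (computable_if hP hQ (computable1 m)) => w v _ _ _.
by case: (P w v).
Qed.

Lemma testable_xor m P Q : testable m P -> testable m Q ->
  testable m (fun w v => P w v (+) Q w v).
Proof.
move=> hP hQ; apply: computable_ext (computable_if hP (testable_not hQ) hQ) => w v _ _ _.
by case: (P w v).
Qed.

(** The loop increments [A] in its first [B] rounds. Likewise, the product adds [A] to 0 in the
    first [B] rounds, and the power doubles 1 in the first [A] rounds. *)
Lemma computable_add m A B : computable m A -> computable m B ->
  computable m (fun w v => minn (size w) (A w v + B w v)).
Proof.
move=> hA hB.
have hG := computable_if
  (testable_lt (@computable_var m.+2 1 isT) (computable_drop 2 hB))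
  (computable_succ (@computable_var m.+2 0 isT)) (@computable_var m.+2 0 isT).
apply: computable_ext (computable_iteri hA hG) => w v w1 sv av /=.
rewrite drop0.
have leA := computable_le hA w1 sv av; have leB := computable_le hB w1 sv av.
rewrite -{2}(minn_idPr leB).
(* Only the number of rounds is generalized, not the truncation bound: after [k] rounds [minn k B]
   increments have been made. *)
elim: {1 4}(size w) => [|k IH] /=; first by rewrite min0n addn0 (minn_idPr leA).
rewrite IH; case: ltnP => kB; lia.
Qed.

Lemma computable_mul m A B : computable m A -> computable m B ->
  computable m (fun w v => minn (size w) (A w v * B w v)).
Proof.
move=> hA hB.
have hG := computable_if
  (testable_lt (@computable_var m.+2 1 isT) (computable_drop 2 hB))
  (computable_add (@computable_var m.+2 0 isT) (computable_drop 2 hA))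
  (@computable_var m.+2 0 isT).
apply: computable_ext (computable_iteri (computable0 m) hG) => w v w1 sv av /=.
rewrite drop0.
have leB := computable_le hB w1 sv av.
rewrite -{2}(minn_idPr leB).
elim: {1 4}(size w) => [|k IH] /=; first by rewrite min0n muln0 minn0.
rewrite IH; case: ltnP => kB.
  by rewrite (minn_idPl kB) mulnS; lia.
by rewrite (minn_idPr (leqW kB)).
Qed.

Lemma computable_pow2 m A : computable m A ->
  computable m (fun w v => minn (size w) (2 ^ A w v)).
Proof.
move=> hA.
have hx := @computable_var m.+2 0 isT.
have hG := computable_if
  (testable_lt (@computable_var m.+2 1 isT) (computable_drop 2 hA))
  (computable_add hx hx) hx.
apply: computable_ext (computable_iteri (computable1 m) hG) => w v w1 sv av /=.
rewrite drop0.
have leA := computable_le hA w1 sv av.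
rewrite -{2}(minn_idPr leA).
elim: {1 4}(size w) => [|k IH] /=; first by rewrite min0n expn0; lia.
rewrite IH; case: ltnP => kA.
  by rewrite (minn_idPl kA) expnS; lia.
by rewrite (minn_idPr (leqW kA)).
Qed.

Lemma computable_count m P : testable m.+1 P ->
  computable m (fun w v => count (fun i => P w (i :: v)) (iota 0 (size w))).
Proof.
move=> hP.
have hx := @computable_var m.+2 0 isT.
have hG := computable_if (computable_drop 1 hP) (computable_succ hx) hx.
apply: computable_ext (computable_iteri (computable0 m) hG) => w v w1 sv av /=.
have := leqnn (size w); elim: {1 3 5}(size w) => [//|k IH] kw.
have -> : iota 0 k.+1 = rcons (iota 0 k) k by rewrite -cats1 -addn1 iotaD.
rewrite -cats1 count_cat /= addn0 IH; last exact: ltnW.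
(* The count so far is at most [k < size w], so the increment is not truncated. *)
have := count_size (fun i => P w (i :: v)) (iota 0 k); rewrite size_iota.
by case: ifP => _; rewrite ?addn0 //; lia.
Qed.

Lemma testable_all m P : testable m.+1 P ->
  testable m (fun w v => all (fun i => P w (i :: v)) (iota 0 (size w))).
Proof.
move=> hP.
have hN := testable_not (testable_lt (computable0 m) (computable_count (testable_not hP))).
apply: computable_ext hN => w v _ _ _; congr nat_of_bool.
by rewrite -has_count -all_predC; apply: eq_all => i /=; rewrite negbK.
Qed.

(** * The decision procedure on adjacency matrices *)

(** An integer square root: on a word of length [n * n] the condition says [m < n], and truncating
    the product at [size w] does not affect it. *)
Definition word_dim (w : seq bool) : nat :=
  count (fun m => minn (size w) (m * m) < size w) (iota 0 (size w)).

Definition row0_ones (w : seq bool) (n : nat) : nat :=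
  count (fun j => (j < n) && nth false w j) (iota 0 (size w)).

Definition row0_zeros (w : seq bool) (n : nat) : nat :=
  count (fun j => (j < n) && ~~ nth false w j) (iota 0 (size w)).

(** Entry (i, j) has to be the exclusive or of entries i and j of the first row. Each [minn]
    reproduces the truncation of register arithmetic. *)
Definition rows_equal_or_opposite (w : seq bool) (n : nat) : bool :=
  all (fun i => all (fun j => (i < n) && (j < n) ==>
      ~~ (nth false w (minn (size w) (minn (size w) (i * n) + j)) (+)
          (nth false w i (+) nth false w j)))
    (iota 0 (size w))) (iota 0 (size w)).

Definition accepts (w : seq bool) (n : nat) : bool :=
  [&& 2 < n, rows_equal_or_opposite w n,
      ~~ (minn (size w) (2 ^ row0_zeros w n) < row0_ones w n)
    & ~~ (minn (size w) (2 ^ row0_ones w n) < row0_zeros w n)].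

Lemma testable_accepts : testable 0 (fun w v => accepts w (word_dim w)).
Proof.
have hn : computable 0 (fun w v => word_dim w).
  have h0 := @computable_var 1 0 isT.
  exact: computable_count (testable_lt (computable_mul h0 h0) (computable_size 1)).
suff h : testable 1 (fun w v => accepts w (nth 0 v 0)).
  exact: (computable_let hn h).
have v10 := @computable_var 1 0 isT.
have v20 := @computable_var 2 0 isT; have v21 := @computable_var 2 1 isT.
have h1 : computable 1 (fun w v => row0_ones w (nth 0 v 0)).
  exact: computable_count (testable_and (testable_lt v20 v21) (testable_bit v20)).
have h0 : computable 1 (fun w v => row0_zeros w (nth 0 v 0)).
  exact: computable_count
    (testable_and (testable_lt v20 v21) (testable_not (testable_bit v20))).
apply: testable_and; first exact: testable_lt (computable2 1) v10.
apply: testable_and; last first.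
  apply: testable_and; apply: testable_not; apply: testable_lt => //;
    exact: computable_pow2.
have j := @computable_var 3 0 isT; have i := @computable_var 3 1 isT.
have n := @computable_var 3 2 isT.
have hb := testable_xor
  (testable_bit (computable_add (computable_mul i n) j))
  (testable_xor (testable_bit i) (testable_bit j)).
exact: testable_all (testable_all (testable_imply
  (testable_and (testable_lt i n) (testable_lt j n)) (testable_not hb))).
Qed.

Definition decides_in_poly (P : seq bool -> bool) (M : TM) (d : nat) :=
  forall w, 1 < size w -> exists2 t, t <= size w ^ d &
    (tm_run M t w).1 = if P w then tm_acc M else tm_rej M.

Lemma testable_TM P : testable 0 (fun w v => P w) ->
  exists M d, tm_wf M /\ decides_in_poly P M d.
Proof.
case=> gen [cost pc h]; set c := gen [::] 1.
(* Register 1 holds the answer. If it is 1, the final test falls through to [size C], which accepts;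
   otherwise it skips to [(size C).+1], which rejects. *)
pose C := c ++ [:: IZero 2; ILt 2 1 1].
have [d hd] : poly_bounded (fun N => (cost N + 2) * (N + (N + 2))).
  have pk := poly_const.
  exact: poly_mul (poly_add pc (pk 2)) (poly_add poly_id (poly_add poly_id (pk 2))).
exists (compiled C), d; split; first exact: compiled_wf.
move=> w w1.
pose s0 : store := fun=> size w.
have hC : runs C w (cost (size w) + 1) 0 (c ++ [:: IZero 2]) s0
    (fun s => s 1 = P w /\ s 2 = 0).
  apply: runs_cat (h _ _ _ _ _ _ w1 _ _ _ _ _) _ => // s b [s1 _].
  apply: runs_cons => // [|b']; first exact: ltnW.
  by apply: runs_nil => //=; rewrite /upd.
have cC : C = (c ++ [:: IZero 2]) ++ [:: ILt 2 1 1] by rewrite -catA.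
have [|s [[t tle te] b [s1 s2]]] := hC.
  by move=> i ic; rewrite cC add0n onth_cat ic.
have e : iter t.+1 (step C w) (0, s0) = (if P w then size C else (size C).+1, s).
  rewrite iterS te /step /= add0n {1}cC onth_cat ltnn subnn /= s1 s2 lt0b.
  by rewrite /C !size_cat /= addn1 addn2 addn1.
have C0 : 0 < size C by rewrite size_cat addn2.
have := @compiled_run C t.+1 ord0 w s0 0 0 (ltnW w1) (fun=> leqnn _) C0.
rewrite [val ord0]/= e.
case=> [|t' t'le t'e]; first by case: (P w).
exists t'.
  apply: leq_trans t'le _; apply: leq_trans (hd _ w1).
  by rewrite addn2 leq_mul //; lia.
(* The unmarked input is the tape of [s0], because the value [size w] marks no cell. *)
have -> : tm_run (compiled C) t' w =
    iter t' (@tm_step (compiled C)) (tape_conf ord0 w s0 0 0).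
  congr (iter _ _ _); rewrite /tape_conf cats0.
  have m0 p k : p + k <= size w -> 0 < k -> marks (width C) s0 p = [ffun=> false].
    by move=> pk k0; apply/ffunP => i; rewrite !ffunE /s0; apply/eqP; lia.
  have cE w' p : p + size w' <= size w ->
      map Some (cells (width C) p w' s0) = map (@tm_enc (compiled C)) w'.
    elim: w' p => [//|b' w' IH] p /= pw; rewrite IH ?addSnnS //.
    by rewrite (m0 _ _ pw) //; case: b'.
  by rewrite cE //; case: (w) w1.
by rewrite t'e; case: (P w); rewrite ?eqxx // gtn_eqF.
Qed.

(** * Graphs with rainbow connection number two *)

Lemma nth_allpairs T1 T2 R (f : T1 -> T2 -> R) s t x1 x2 x0 i j :
  i < size s -> j < size t ->
  nth x0 [seq f x y | x <- s, y <- t] (i * size t + j) = f (nth x1 s i) (nth x2 t j).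
Proof.
move=> + jt; elim: s i => [//|x s IH] [|i] /= it; rewrite nth_cat size_map.
  by rewrite mul0n add0n jt (nth_map x2).
by rewrite mulSn -addnA ltnNge leq_addr /= addKn IH.
Qed.

Lemma nth_graph_code n (e : rel 'I_n) (i j : 'I_n) :
  nth false (graph_code e) (i * n + j) = e i j.
Proof.
by rewrite -{3}(size_enum_ord n) (nth_allpairs _ i j) ?size_enum_ord // !nth_ord_enum.
Qed.

Lemma size_graph_code n (e : rel 'I_n) : size (graph_code e) = n * n.
Proof. by rewrite size_allpairs size_enum_ord. Qed.

Lemma count_iota_ord n N (Q : nat -> bool) : n <= N ->
  count (fun j => (j < n) && Q j) (iota 0 N) = #|[set j : 'I_n | Q j]|.
Proof.
move=> nN; rewrite -(subnKC nN) iotaD count_cat add0n.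
have /eqP -> : count (fun j => (j < n) && Q j) (iota n (N - n)) == 0.
  rewrite -leqn0 leqNgt -has_count; apply/hasPn => j.
  by rewrite mem_iota => /andP[nj _]; rewrite /= ltnNge nj.
rewrite addn0 -val_enum_ord count_map enumT cardE /enum_mem size_filter.
by apply: eq_count => j; rewrite /= inE ltn_ord.
Qed.

Lemma word_dim_graph_code n (e : rel 'I_n) : word_dim (graph_code e) = n.
Proof.
rewrite /word_dim size_graph_code.
have nN : n <= n * n by case: (n) => // k; rewrite leq_pmulr.
rewrite -[RHS](card_ord n) -cardsT.
have -> : [set: 'I_n] = [set j : 'I_n | true] by apply/setP => j; rewrite !inE.
rewrite -(count_iota_ord (fun=> true) nN).
apply: eq_count => m; rewrite andbT gtn_min ltnn /=.
by rewrite !mulnn ltn_sqr.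
Qed.

(** The sides are the neighbours and the non-neighbours of [o]; the equation says that the edges are
    exactly the pairs across. *)
Definition complete_bipartite_code n (e : rel 'I_n) (o : 'I_n) :=
  [/\ 2 < n, forall i j, e i j = e o i (+) e o j,
      #|[set j | e o j]| <= 2 ^ #|[set j | ~~ e o j]|
    & #|[set j | ~~ e o j]| <= 2 ^ #|[set j | e o j]|].

Lemma accepts_graph_code n (e : rel 'I_n) (o : 'I_n) : val o = 0 ->
  reflect (complete_bipartite_code e o)
    (accepts (graph_code e) (word_dim (graph_code e))).
Proof.
move=> o0; rewrite word_dim_graph_code.
set w := graph_code e; have sw : size w = n * n := size_graph_code e.
have n0 : 0 < n by apply: leq_ltn_trans (ltn_ord o).
have nN : n <= n * n by rewrite leq_pmulr.
have wo (j : 'I_n) : nth false w j = e o j.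
  by rewrite -nth_graph_code o0 mul0n add0n.
have ones : row0_ones w n = #|[set j | e o j]|.
  rewrite /row0_ones sw (count_iota_ord (nth false w)) //.
  by congr #|pred_of_set _|; apply/setP => j; rewrite !inE wo.
have zeros : row0_zeros w n = #|[set j | ~~ e o j]|.
  rewrite /row0_zeros sw (count_iota_ord (fun j => ~~ nth false w j)) //.
  by congr #|pred_of_set _|; apply/setP => j; rewrite !inE wo.
(* Cardinalities are at most [n <= size w], so truncating the power does not change the
   comparison. *)
have leN (A : {set 'I_n}) x : ~~ (minn (size w) x < #|A|) = (#|A| <= x).
  have : #|A| <= n by rewrite -[leqRHS]card_ord max_card.
  by rewrite sw; lia.
rewrite /accepts ones zeros !leN.
have rowsP : reflect (forall i j, e i j = e o i (+) e o j) (rows_equal_or_opposite w n).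
  apply: (iffP allP) => [h i j|h i _].
    have iN (k : 'I_n) : val k \in iota 0 (size w).
      by rewrite mem_iota sw add0n; apply: leq_trans (ltn_ord k) nN.
    have /allP/(_ _ (iN j)) := h _ (iN i).
    rewrite !ltn_ord /= !wo sw.
    have lt : i * n + j < n * n.
      have := ltn_ord i; have := ltn_ord j; nia.
    rewrite (minn_idPr (_ : i * n <= n * n)); last by lia.
    rewrite (minn_idPr (ltnW lt)) nth_graph_code.
    by move/negbTE/addbP; case: (e i j) (_ (+) _) => -[].
  apply/allP => j _; apply/implyP => /andP[lti ltj].
  rewrite -[i]/(val (Ordinal lti)) -[j]/(val (Ordinal ltj)) !wo sw.
  have lt : i * n + j < n * n by nia.
  rewrite (minn_idPr (_ : i * n <= n * n)); last by lia.
  by rewrite (minn_idPr (ltnW lt)) (nth_graph_code e (Ordinal lti) (Ordinal ltj)) h addbb.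
by apply: (iffP and4P) => -[? /rowsP ? ? ?]; split=> //; apply/rowsP.
Qed.

(** * Rainbow colorings with two colors *)

Section RainbowTwo.

Variables (n : nat) (e : rel 'I_n).

Lemma rainbow_size k (c : 'I_n -> 'I_n -> 'I_k) u v p :
  rainbow_path e c u v p -> size p <= k.
Proof.
case=> _ _ _ /card_uniqP; rewrite size_pairmap => <-.
by rewrite -[leqRHS]card_ord; apply: max_card.
Qed.

Lemma rainbow1_adjacent (c : 'I_n -> 'I_n -> 'I_1) u v :
  rainbow_coloring e c -> u != v -> e u v.
Proof.
case=> _ /(_ u v)[p hp] uv; have := rainbow_size hp.
case: p hp => [|x [|//]] [] /=; first by move=> _ /eqP; rewrite (negbTE uv).
by rewrite andbT => eux <-.
Qed.

Lemma rainbow2_path (c : 'I_n -> 'I_n -> 'I_2) u v :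
  rainbow_coloring e c -> u != v ->
  e u v \/ exists x, [/\ e u x, e x v & c u x != c v x].
Proof.
case=> sc /(_ u v)[p hp] uv; have := rainbow_size hp.
case: p hp => [|x [|y [|//]]] [] /=; first by move=> _ /eqP; rewrite (negbTE uv).
  by rewrite andbT => eux <-; left.
rewrite !inE !andbT => /andP[eux exy] <- _ ne _; right; exists x.
by rewrite (sc y) eux exy.
Qed.

Hypothesis he : simple_graph e.

Lemma rc_complete_bipartite (o : 'I_n) : 1 < n -> bipartite e -> rc_eq e 2 ->
  complete_bipartite_code e o.
Proof.
case: he => esym eirr n1 [side hs] [[c hc] hmin].
(* A path with two edges returns to its own side, so vertices on opposite sides must be adjacent. *)
have eE u v : e u v = (side u != side v).
  apply/idP/idP; first exact: hs.
  move=> suv; have uv : u != v by apply: contraNneq suv => ->.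
  have [//|[x [/hs h1 /hs h2 _]]] := rainbow2_path hc uv.
  by move: suv h1 h2; case: (side u) (side v) (side x) => -[] [].
have eo i j : e i j = e o i (+) e o j.
  by rewrite !eE; case: (side i) (side j) (side o) => -[] [].
(* Two vertices of the independent set [A] need a common neighbour, necessarily in [B], that they
   reach in different colors. Hence a vertex of [A] is determined by the subset of [B] that it
   reaches in color 0. *)
have inj (A B : {set 'I_n}) : (forall u v, u \in A -> v \in A -> ~~ e u v) ->
    (forall u x, u \in A -> e u x -> x \in B) -> #|A| <= 2 ^ #|B|.
  move=> hA hAB; rewrite -card_powerset.
  pose f u := [set x in B | c u x == ord0].
  rewrite -(card_in_imset (f := f) (D := mem A)).
    by apply/subset_leq_card/subsetP => _ /imsetP[u _ ->]; rewrite inE;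
      apply/subsetP => x; rewrite inE => /andP[].
  move=> u v uA vA fuv; apply/eqP/negPn/negP => uv.
  have [|[x [eux exv]]] := rainbow2_path hc uv; first exact/negP/hA.
  have := congr1 (fun X : {set _} => x \in X) fuv; rewrite !inE (hAB u x uA eux) /=.
  by case: (c u x) (c v x) => -[|[|//]] ? [[|[|//]] ?].
split=> //.
(* On two vertices one color is enough: a path with two edges would need a third vertex. *)
- rewrite ltnNge; apply/negP => n2.
  have n2E : n = 2 by apply/eqP; rewrite eqn_leq n2.
  apply: (hmin 1) => //; exists (fun _ _ => ord0); split=> // u v.
  have [->|uv] := eqVneq u v; first by exists [::]; split.
  exists [:: v]; split=> //=; rewrite ?andbT ?inE //.
  have [//|[x [eux exv _]]] := rainbow2_path hc uv.
  have xu : x != u by apply: contraTneq eux => ->; apply: eirr.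
  have xv : x != v by apply: contraTneq exv => ->; apply: eirr.
  have : #|[set x; u; v]| <= n by rewrite -[leqRHS]card_ord; apply: max_card.
  by rewrite -setUA cardsU1 !inE negb_or xu xv cards2 uv n2E.
- apply: inj => u v; rewrite !inE (eo u v); first by move=> -> ->.
  by move=> ->; case: (e o v).
- apply: inj => u v; rewrite !inE (eo u v); first by move=> /negbTE-> /negbTE->.
  by move=> /negbTE->.
Qed.

(* Label the vertices of the larger side by distinct subsets of [A], among them all
   singletons; the edge [ab] is coloured according to whether [a] is in the label of [b]. *)
Lemma complete_bipartite_coloring (A : {set 'I_n}) :
  (forall i j, e i j = (i \in A) (+) (j \in A)) -> 0 < #|A| ->
  #|A| <= #|~: A| -> #|~: A| <= 2 ^ #|A| ->
  exists c : 'I_n -> 'I_n -> 'I_2, rainbow_coloring e c.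
Proof.
move=> eE A0 AB BA.
pose singles := [seq [set a] | a <- enum A].
pose labels := singles ++ [seq X <- enum (powerset A) | X \notin singles].
pose f b := nth set0 labels (index b (enum (~: A))).
have us : uniq singles by rewrite map_inj_uniq ?enum_uniq //; apply: set1_inj.
have ul : uniq labels.
  rewrite cat_uniq us filter_uniq ?enum_uniq // andbT; apply/hasPn => X.
  by rewrite mem_filter => /andP[].
have memX X : X \in labels = (X \subset A).
  rewrite mem_cat mem_filter mem_enum inE.
  have [/mapP[a]|] //= := boolP (X \in singles).
  by rewrite mem_enum => aA ->; rewrite sub1set.
have sl : size labels = 2 ^ #|A|.
  rewrite -card_powerset cardE; apply/perm_size/uniq_perm => //; first exact: enum_uniq.
  by move=> X; rewrite memX mem_enum inE.
(* There are enough labels by the bound [2 ^ #|A|], so the default [set0] in [f] is never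
   reached. *)
have idx b : b \notin A -> index b (enum (~: A)) < size labels.
  move=> bA; rewrite sl; apply: leq_trans BA.
  by rewrite cardE index_mem mem_enum inE.
have finj b b' : b \notin A -> b' \notin A -> f b = f b' -> b = b'.
  move=> bA bA' /eqP; rewrite nth_uniq ?idx // => /eqP /(congr1 (nth b (enum (~: A)))).
  by rewrite !nth_index // mem_enum inE.
have fsub b : b \notin A -> f b \subset A by move=> bA; rewrite -memX mem_nth ?idx.
(* The singletons come first in [labels] and [#|A| <= #|~: A|], so each of them is used. *)
have fsingle a : a \in A -> exists2 b, b \notin A & f b = [set a].
  move=> aA; have ia : index a (enum A) < #|A| by rewrite cardE index_mem mem_enum.
  have ib : index a (enum A) < size (enum (~: A)) by rewrite -cardE (leq_trans ia).
  exists (nth a (enum (~: A)) (index a (enum A))).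
    by have := mem_nth a ib; rewrite mem_enum inE.
  rewrite /f index_uniq ?enum_uniq // nth_cat size_map -cardE ia.
  by rewrite (nth_map a) -?cardE // nth_index // mem_enum.
pose b2 (b : bool) : 'I_2 := if b then ord_max else ord0.
pose c x y := b2 ([&& x \in A, y \notin A & x \in f y] || [&& y \in A, x \notin A & y \in f x]).
have cE a b : a \in A -> b \notin A -> c a b = b2 (a \in f b).
  by move=> aA bA; rewrite /c aA (negbTE bA) /= orbF.
have cs x y : c x y = c y x by rewrite /c orbC.
have path2 u v x : u != v -> e u x -> e x v -> c u x != c x v ->
    exists p, rainbow_path e c u v p.
  move=> uv eux exv cuv; exists [:: x; v]; split=> //=; rewrite ?eux ?exv ?inE ?cuv //.
  rewrite negb_or uv !andbT; apply/andP; split.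
    by apply: contraTneq eux => ->; rewrite eE addbb.
  by apply: contraTneq exv => ->; rewrite eE addbb.
exists c; split=> // u v.
have [->|uv] := eqVneq u v; first by exists [::]; split.
have [euv|] := boolP (e u v).
  by exists [:: v]; split=> //=; rewrite ?euv ?inE ?uv.
rewrite eE; case uA: (u \in A); case vA: (v \in A) => // _.
  (* For [u] and [v] in [A], the vertex labelled by the singleton of [u] tells them apart. *)
  have [b bA fb] := fsingle u uA.
  apply: (@path2 u v b) => //; rewrite ?eE ?uA ?vA ?(negbTE bA) //.
  by rewrite (cs b) !cE // fb !inE eqxx (eq_sym v) (negbTE uv).
have := contra_neq (finj u v (negbT uA) (negbT vA)) uv.
rewrite eqEsubset negb_and => nsub.
(* For [u] and [v] outside [A], any element of the symmetric difference of their labels is a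
   suitable middle vertex. *)
have [a aA ne] : exists2 a, a \in A & (a \in f u) != (a \in f v).
  case/orP: nsub => /subsetPn[a au av]; exists a; rewrite ?au ?(negbTE av) //.
    exact: (subsetP (fsub u (negbT uA))).
  exact: (subsetP (fsub v (negbT vA))).
apply: (@path2 u v a) => //; rewrite ?eE ?uA ?vA ?aA //.
rewrite (cs u) !cE ?uA ?vA //.
by move: ne; case: (a \in f u); case: (a \in f v).
Qed.

Lemma complete_bipartite_rc (o : 'I_n) : complete_bipartite_code e o -> rc_eq e 2.
Proof.
case: he => esym eirr [n2 eE TS ST]; split.
  set T := [set j | e o j] in TS ST *.
  have SE : [set j | ~~ e o j] = ~: T by apply/setP => j; rewrite !inE.
  rewrite SE in TS ST.
  have oS : o \in ~: T by rewrite !inE.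
  have S0 : 0 < #|~: T| by apply/card_gt0P; exists o.
  (* If [T] were empty, the other side would have all [n > 2] vertices, more than [2 ^ 0]. *)
  have T0 : 0 < #|T|.
    rewrite lt0n; apply/negP => /eqP T0; have := cardsC T; rewrite T0 card_ord add0n.
    by move: ST; rewrite T0 => + sn; rewrite sn leqNgt (ltnW n2).
  (* The smaller side takes the role of [A]. *)
  case: (leqP #|T| #|~: T|) => [le|/ltnW le].
    by apply: (@complete_bipartite_coloring T) => // i j; rewrite eE !inE.
  apply: (@complete_bipartite_coloring (~: T)); rewrite ?setCK // => i j.
  by rewrite eE !inE; case: (e o i); case: (e o j).
case=> [|[|//]] _ [c hc]; first by case: (c o o).
(* With one color all pairs are adjacent, but three vertices of a bipartite graph cannot form a
   triangle. *)
pose x0 : 'I_n := Ordinal (ltn_trans (ltn0Sn 1) n2).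
pose x1 : 'I_n := Ordinal (ltn_trans (ltnSn 1) n2).
pose x2 : 'I_n := Ordinal n2.
have := rainbow1_adjacent hc (isT : x0 != x1); have := rainbow1_adjacent hc (isT : x0 != x2).
have := rainbow1_adjacent hc (isT : x1 != x2).
by rewrite (eE x0 x1) (eE x0 x2) (eE x1 x2); case: (e o x0) (e o x1) (e o x2) => -[] [].
Qed.

End RainbowTwo.

Theorem theorem3 :
  exists (M : TM) (d : nat),
    tm_wf M /\
    forall (n : nat) (e : rel 'I_n),
      simple_graph e -> 1 < n -> connected_graph e -> bipartite e ->
      exists t : nat,
        t <= (size (graph_code e)) ^ d + d /\
        (rc_eq e 2 -> (tm_run M t (graph_code e)).1 = tm_acc M) /\
        (~ rc_eq e 2 -> (tm_run M t (graph_code e)).1 = tm_rej M).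
Proof.
have [M [d [wfM decM]]] := testable_TM testable_accepts.
exists M, d; split=> // n e se n1 _ be.
pose o : 'I_n := Ordinal (ltnW n1).
have w1 : 1 < size (graph_code e) by rewrite size_graph_code; nia.
have [t tle te] := decM _ w1; exists t; split; first exact: leq_trans tle (leq_addr _ _).
rewrite te; case: (accepts_graph_code e (erefl : val o = 0)) => h; split=> //.
  by case; apply: complete_bipartite_rc h.
by move/(rc_complete_bipartite se o n1 be).
Qed.
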